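(* Let $k\ge 1$ be an integer and let $F:\mathbb{N}^k\to\mathbb{C}$ be an arbitrary function. Let $t$ be a real number with $0<t\le 1$, and assume that the multiple Dirichlet series $$\sum_{n_1,\ldots,n_k=1}^{\infty}\frac{(\mu*F)(n_1,\ldots,n_k)}{n_1^{z_1}\cdots n_k^{z_k}}$$ is absolutely convergent for all $z_1,\ldots,z_k\in\mathbb{C}$ with $\Re z_j\ge t$ ($1\le j\le k$). Put $$B_{F,k}:=\sum_{n_1,\ldots,n_k=1}^{\infty}\frac{(\mu*F)(n_1,\ldots,n_k)}{n_1\cdots n_k}.$$ i) If $t=1$, then $$\lim_{x\to\infty}\frac{1}{x^{k/2}}\sum_{\substack{n_1,\ldots,n_k\in\mathbb{N}\\ n_1^2+\cdots+n_k^2\le x}}F(n_1,\ldots,n_k)=\frac{V_k}{2^k}B_{F,k}.$$ ii) If $0<t<1$, then $$\sum_{\substack{n_1,\ldots,n_k\in\mathbb{N}\\ n_1^2+\cdots+n_k^2\le x}}F(n_1,\ldots,n_k)=\frac{V_k}{2^k}B_{F,k}\,x^{k/2}+O\left(x^{(k-1+t)/2}\right).$$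
   Context: $\mathbb{N}=\{1,2,\ldots\}$. $V_k=\pi^{k/2}/\Gamma(k/2+1)$ is the volume of the $k$-dimensional unit ball. For $F,G:\mathbb{N}^k\to\mathbb{C}$ the convolution is $(F*G)(n_1,\ldots,n_k)=\sum_{d_1\mid n_1,\ldots,d_k\mid n_k}F(d_1,\ldots,d_k)\,G(n_1/d_1,\ldots,n_k/d_k)$. The $k$-variable Möbius function is $\mu(n_1,\ldots,n_k)=\mu(n_1)\cdots\mu(n_k)$, where $\mu$ on the right is the classical Möbius function; thus $(\mu*F)$ is the $k$-variable convolution of this function with $F$. The $O$-estimate is as $x\to\infty$, with implied constant depending on $F$, $k$ and $t$. *)

(* Defs.v *)
From mathcomp Require Import all_boot all_order all_algebra.
From mathcomp Require Import all_classical all_reals all_analysis.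
From mathcomp Require Import complex.
From mathcomp.analysis.showcase Require summability.
Set Implicit Arguments.
Unset Strict Implicit.
Unset Printing Implicit Defensive.
Import Order.TTheory GRing.Theory Num.Theory.
Import numFieldNormedType.Exports.
Local Open Scope classical_set_scope.
Local Open Scope ring_scope.
Local Open Scope complex_scope.

(* The complex numbers over R.  [R[i]] itself carries no topology; seen as a
   numClosedFieldType it inherits the one given by the norm [`|_|]. *)
Definition Cplx (R : realType) : numClosedFieldType := R[i].

Section Dirichlet.
Variable R : realType.
Local Notation C := (Cplx R).

Definition cmod (z : C) : R := complex.Re `|z|.

Definition cexp (z : C) : C :=
  (expR (complex.Re z))%:C * (cos (complex.Im z) +i* sin (complex.Im z)).

(* The power n^z = exp(z log n), for n > 0. *)
Definition natpowC (n : nat) (z : C) : C := cexp (z * (ln n%:R)%:C).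

Definition moebius (n : nat) : int :=
  if all (fun p => logn p n == 1%N) (primes n)
  then (-1) ^+ size (primes n) else 0.

Variable k : nat.
Local Notation vec := {ffun 'I_k -> nat}.

(* The set N^k, where N = {1, 2, ...}.  A function N^k -> C is represented by a
   function on all of [vec], only the values of which on [posvec] are used. *)
Definition posvec : set vec := [set n | forall i, (0 < n i)%N].

(* For n in [posvec] the index set is finite and contained in [posvec]. *)
Definition dconv (F G : vec -> C) (n : vec) : C :=
  \sum_(d \in [set d : vec | forall i, (d i %| n i)%N])
    F d * G [ffun i => (n i %/ d i)%N].

Definition moebiusv (n : vec) : C := \prod_(i < k) (moebius (n i))%:~R.

(* Absolute convergence, and sum, of a multiple series over N^k.  The sum is the
   limit of the net of the sums over the finite subsets of N^k. *)
Definition abs_convergent (a : vec -> C) : Prop :=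
  summable posvec (fun n => (cmod (a n))%:E).

Definition series_sum (a : vec -> C) : C :=
  summability.sum (patch (fun=> 0) posvec a).

Definition BF (F : vec -> C) : C :=
  series_sum (fun n => dconv moebiusv F n / \prod_(i < k) (n i)%:R).

Definition ball_sum (F : vec -> C) (x : R) : C :=
  \sum_(n \in [set n : vec | posvec n /\ (\sum_(i < k) n i ^ 2)%N%:R <= x]) F n.

End Dirichlet.

Definition Gamma (R : realType) (s : R) : R :=
  \int[lebesgue_measure]_(u in `]0, +oo[) (u `^ (s - 1) * expR (- u)).

Definition unit_ball_volume (R : realType) (k : nat) : R :=
  pi `^ (k%:R / 2) / Gamma (k%:R / 2 + 1).

(* Main.v *)
Require Import Defs.
From mathcomp Require Import all_boot all_order all_algebra.
From mathcomp Require Import all_classical all_reals all_analysis.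
From mathcomp Require Import complex.
From mathcomp Require Import measurable_realfun finmap.
From mathcomp Require Import ring lra zify.
Import Order.TTheory GRing.Theory Num.Theory.
Import numFieldNormedType.Exports.
Local Open Scope classical_set_scope.
Local Open Scope ring_scope.
Local Open Scope complex_scope.
Set Implicit Arguments.
Unset Strict Implicit.
Unset Printing Implicit Defensive.

(** Put g = mu * F.  By Moebius inversion F(n) is the sum of g(d) over the
    vectors d dividing n, so that the sum of F over the ball of radius y is
    the sum over d of g(d) N_d(y), where N_d(y) is the number of vectors n in
    the ball with positive coordinates n_i divisible by d_i
    ([ball_sum_fset], from [moebius_inversion]).

    Writing P for the product and S for the sum of the d_i, and c_k for
    V_k / 2^k, the lattice points are counted uniformly in d by
      c_k y^k / P - y^(k-1) S / P <= N_d(y) <= c_k y^k / P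
    ([sublattice_count_bounds]).  This goes by induction on k: fixing the first
    coordinate m d_1, the others run through a lattice in a ball of radius
    y sqrt (1 - (m h)^2), h = d_1 / y, and the sum over m is a Riemann
    sum of the decreasing function sqrt (1 - u^2)^k on [0, 1]
    ([wallis_riemann]).  Its integral W_k is obtained from the substitution
    u = sin x, and the constant of the induction is the product of
    W_0, .., W_(k-1).  That this product is V_k / 2^k
    ([unit_ball_volumeE]) follows from W_(k+1) W_k = pi / (2 (k + 2)) and from
    the moments of the Gaussian, since Gamma (k / 2 + 1) is twice the integral
    of v^(k+1) exp (- v^2) over the half line.

    The error in N_d(y) is thus at most (y^k / P) min (1, S / y)
    ([sublattice_count_err]).  If t = 1, the series of |g(d)| / P converges, so
    that the first bound controls the tail of the sum over d while the second
    makes any finite part o(y^k) ([ball_sum_main_term]).  If t < 1, then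
    min (1, S / y) is at most the sum over j of (d_j / y)^(1 - t), and
    |g(d)| d_j^(1 - t) / P is summable by the hypothesis for z_j = t and the
    other z_i equal to 1, which gives the error y^(k - 1 + t)
    ([ball_sum_error_term]). *)

(** * Riemann sums of a power of [sqrt (1 - u ^ 2)] *)

Section Wallis.
Variable R : realType.
Implicit Types (k : nat) (a b h x : R).

(** Integrating by parts, an antiderivative of [cos x ^+ k.+1] vanishing at 0.
    Through [u = sin x] it integrates [Num.sqrt (1 - u ^+ 2) ^+ k] without
    meeting the singularity of the derivative of [asin] at 1. *)
Fixpoint cosint k (x : R) : R :=
  match k with
  | 0 => sin x
  | 1 => (sin x * cos x + x) / 2
  | k'.+2 => (sin x * cos x ^+ k'.+2 + k'.+2%:R * cosint k' x) / k'.+3%:R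
  end.

Lemma is_derive_cosint k x : is_derive x 1 (cosint k) (cos x ^+ k.+1).
Proof.
suff: is_derive x 1 (cosint k) (cos x ^+ k.+1) /\
      is_derive x 1 (cosint k.+1) (cos x ^+ k.+2) by case.
elim: k => [|k [IH0 IH1]].
  split; first by apply: is_derive_eq; rewrite expr1.
  rewrite /=.
  apply: is_derive_eq.
  rewrite /GRing.scale /=.
  have := cos2Dsin2 x.
  move: (cos x) (sin x) => c s h.
  have -> : s * - s = c ^+ 2 - 1 by rewrite -h; ring.
  by field.
split; first exact: IH1.
rewrite [X in is_derive _ _ X](_ : _ = k.+3%:R^-1 \*:
    (@sin R * @cos R ^+ k.+2 + k.+2%:R \*: cosint k)); last first.
  by apply/funext => y /=; rewrite /GRing.scale /= mulrC !fctE.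
apply: is_derive_eq.
rewrite /GRing.scale /= ?fctE.
have := cos2Dsin2 x.
move: (cos x) (sin x) => c s h.
rewrite -[k.+3%:R](natr1 k.+2).
have h1 : s * s = 1 - c ^+ 2 by rewrite -h; ring.
have h3 : k.+2%:R + 1 != 0 :> R by rewrite natr1 pnatr_eq0.
have -> : s * (k.+2%:R * c ^+ k.+1 * - s) =
    - (k.+2%:R * c ^+ k.+1 * (1 - c ^+ 2)).
  by rewrite -h1; ring.
by move: h3; move: (k.+2%:R : R) => K h3; rewrite !exprS; field.
Qed.

Lemma cos_decreasing a b : 0 <= a -> a <= b -> b <= pi / 2 -> cos b <= cos a.
Proof.
move=> a0 ab bp; have p0 := pi_gt0 R.
rewrite leNgt; apply/negP => h.
have : b < a by rewrite -ltr_cos // in_itv /=; apply/andP; split; lra.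
lra.
Qed.

(** On [a, b] the derivative [cos x ^+ k * cos x] of [cosint k] lies between
    the derivatives of [cos b ^+ k * sin x] and [cos a ^+ k * sin x]. *)
Lemma cosint_bounds k a b : 0 <= a -> a <= b -> b <= pi / 2 ->
  (sin b - sin a) * cos b ^+ k <= cosint k b - cosint k a <=
  (sin b - sin a) * cos a ^+ k.
Proof.
move=> a0 ab bp.
have key (C : R) : exists2 c, a <= c <= b &
    cosint k b - cosint k a - C * (sin b - sin a) =
    (cos c ^+ k - C) * cos c * (b - a).
  pose f x := cosint k x - C * sin x.
  have df x : is_derive x 1 f ((cos x ^+ k - C) * cos x).
    have hk := is_derive_cosint k x;
    rewrite (_ : f = cosint k - C \*: @sin R) //.
    apply: is_derive_eq.
    by rewrite /GRing.scale /= exprS mulrBl [cos x * _]mulrC.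
  have [|c cab fE] := @MVT_segment R f _ a b ab (fun x _ => df x).
    by apply: derivable_within_continuous => x _; exact: ex_derive.
  exists c; first by move: cab; rewrite in_itv.
  by rewrite -fE /f; ring.
have cos0 c : a <= c <= b -> 0 <= cos c.
  move=> /andP[ac cb]; apply: cos_ge0_pihalf; have := pi_ge0 R.
  by move=> ?; apply/andP; split; lra.
apply/andP; split.
  have [c cab E] := key (cos b ^+ k).
  rewrite mulrC -subr_ge0 E !mulr_ge0 ?cos0 // ?subr_ge0 //.
  have /andP[ac cb] := cab.
  by rewrite lerXn2r ?nnegrE ?cos0 ?cab ?lexx ?andbT // cos_decreasing //; lra.
have [c cab E] := key (cos a ^+ k).
rewrite mulrC -subr_le0 E mulr_le0_ge0 ?subr_ge0 // mulr_le0_ge0 ?cos0 //.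
have /andP[ac cb] := cab.
by rewrite subr_le0 lerXn2r ?nnegrE ?cos0 ?cab ?lexx // cos_decreasing //; lra.
Qed.

Lemma asin1 : asin 1 = pi / 2 :> R.
Proof.
have p0 := pi_gt0 R.
have h : pi / 2 \in `[(- (pi / 2)), pi / 2 :> R].
  by rewrite in_itv /=; apply/andP; split; lra.
by have := sinK h; rewrite sin_pihalf.
Qed.

Lemma asin0 : asin 0 = 0 :> R.
Proof.
have p0 := pi_gt0 R.
have h : 0 \in `[(- (pi / 2)), pi / 2 :> R].
  by rewrite in_itv /=; apply/andP; split; lra.
by have := sinK h; rewrite sin0.
Qed.

Lemma chord_bounds k a b : 0 <= a -> a <= b -> b <= 1 ->
  (b - a) * Num.sqrt (1 - b ^+ 2) ^+ k <=
    cosint k (asin b) - cosint k (asin a) <=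
  (b - a) * Num.sqrt (1 - a ^+ 2) ^+ k.
Proof.
move=> a0 ab b1.
have aI : -1 <= a <= 1 by apply/andP; split; lra.
have bI : -1 <= b <= 1 by apply/andP; split; lra.
have p0 := pi_gt0 R.
have incr u v : -1 <= u <= 1 -> -1 <= v <= 1 -> u <= v -> asin u <= asin v.
  move=> uI vI uv; rewrite leNgt; apply/negP => h.
  suff : v < u by lra.
  rewrite -[v]asinK ?in_itv //= -[u]asinK ?in_itv //= ltr_sin //.
    by rewrite in_itv /= asin_geNpi2 // asin_lepi2.
  by rewrite in_itv /= asin_geNpi2 // asin_lepi2.
have := @cosint_bounds k (asin a) (asin b).
rewrite !asinK ?in_itv //= !cos_asin //; apply.
- by rewrite -asin0 incr //; apply/andP; split; lra.
- exact: incr.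
- exact: asin_lepi2.
Qed.

(** The integral of [Num.sqrt (1 - u ^+ 2) ^+ k] over [0, 1]. *)
Definition wallis k : R := cosint k (pi / 2).

Lemma cosint0 k : cosint k 0 = 0.
Proof.
suff: cosint k 0 = 0 /\ cosint k.+1 0 = 0 by case.
elim: k => [|k [h0 h1]] /=; first by rewrite sin0 !mul0r addr0 mul0r.
by split; [exact: h1 | rewrite h0 sin0 mul0r mulr0 addr0 mul0r].
Qed.

Lemma wallis_bounds k : 0 <= wallis k <= 1.
Proof.
have := @chord_bounds k 0 1 (lexx _) ler01 (lexx _).
rewrite asin1 asin0 cosint0 !subr0 !mul1r expr1n expr0n /= subrr subr0.
rewrite sqrtr0 sqrtr1 expr1n => /andP[h0 ->]; rewrite andbT.
by apply: le_trans h0; rewrite exprn_ge0.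
Qed.

Lemma wallisSS k : wallis k.+2 = k.+2%:R / k.+3%:R * wallis k.
Proof.
by rewrite /wallis /= cos_pihalf expr0n /= mulr0 add0r mulrAC.
Qed.

(** By [wallisSS] the product on the left is multiplied by
    [k.+2%:R / k.+3%:R] when [k] increases by 1. *)
Lemma wallis_mul k : wallis k.+1 * wallis k = pi / 2 / k.+2%:R.
Proof.
elim: k => [|k IH].
  by rewrite /wallis /= sin_pihalf cos_pihalf mulr0 add0r mulr1.
rewrite wallisSS -[_ * wallis k.+1]mulrA [wallis k * _]mulrC IH.
have h2 : k.+2%:R != 0 :> R by rewrite pnatr_eq0.
have h3 : k.+3%:R != 0 :> R by rewrite pnatr_eq0.
by move: h2 h3; move: (k.+2%:R : R) (k.+3%:R : R) => x y *; field; apply/andP.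
Qed.

(** Since the function decreases from 1, its right Riemann sum of step [h] is a
    lower bound of the integral, and the left one, larger by at most [h], an
    upper bound.  The last interval, from [M%:R * h] to 1, may be shorter than
    [h]. *)
Lemma wallis_riemann k h (M : nat) : 0 < h -> M%:R * h <= 1 < M.+1%:R * h ->
  wallis k - h <= h * \sum_(m < M) Num.sqrt (1 - (m.+1%:R * h) ^+ 2) ^+ k
    <= wallis k.
Proof.
move=> h0 /andP[Mh1 hM1].
pose f m : R := Num.sqrt (1 - (m%:R * h) ^+ 2) ^+ k.
pose g m : R := cosint k (asin (m%:R * h)).
have step m : (m < M)%N -> h * f m.+1 <= g m.+1 - g m <= h * f m.
  move=> mM; have := @chord_bounds k (m%:R * h) (m.+1%:R * h).
  have -> : m.+1%:R * h - m%:R * h = h by rewrite -natr1; ring.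
  apply.
  - by rewrite mulr_ge0 // ltW.
  - by rewrite ler_wpM2r ?ler_nat // ltW.
  - by rewrite (le_trans _ Mh1) // ler_wpM2r ?ler_nat // ltW.
have tele : g M = \sum_(m < M) (g m.+1 - g m).
  have g0 : g 0%N = 0 by rewrite /g mul0r asin0 cosint0.
  rewrite -(big_mkord predT (fun m => g m.+1 - g m)) telescope_sumr //.
  by rewrite g0 subr0.
have last := @chord_bounds k (M%:R * h) 1 _ Mh1 (lexx _).
have {last} /andP[last0 last1] := last (mulr_ge0 (ler0n _ _) (ltW h0)).
rewrite expr1n subrr sqrtr0 asin1 -/(f M) -/(g M) in last0 last1.
have gM : g M <= wallis k.
  rewrite -subr_ge0; apply: le_trans last0.
  by rewrite mulr_ge0 ?exprn_ge0 // subr_ge0.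
have up : h * \sum_(m < M) f m.+1 <= g M.
  by rewrite tele mulr_sumr ler_sum // => m _; case/andP: (step m (ltn_ord m)).
have lo : g M <= h * \sum_(m < M) f m.
  by rewrite tele mulr_sumr ler_sum // => m _; case/andP: (step m (ltn_ord m)).
apply/andP; split; last exact: le_trans gM.
have f0 : f 0 = 1 by rewrite /f mul0r expr0n /= subr0 sqrtr1 expr1n.
have fM0 : 0 <= f M by rewrite exprn_ge0.
have lM : (1 - M%:R * h) * f M <= h * f M.
  by apply: ler_wpM2r => //; move: hM1; rewrite -natr1; lra.
have shift : \sum_(m < M) f m + f M = 1 + \sum_(m < M) f m.+1.
  by rewrite -f0 -(big_ord_recr M (fun m => f (nat_of_ord m))) big_ord_recl.
have : wallis k <= h * (\sum_(m < M) f m + f M).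
  rewrite mulrDr; apply: le_trans (lerD lo lM).
  rewrite -lerBlDl; exact: last1.
rewrite shift /f; lra.
Qed.

End Wallis.

(** * Sublattices of Z^k in a ball *)

Section FfunCons.
Variables (k : nat) (T : Type).

Definition ffcons (a : T) (n : {ffun 'I_k -> T}) : {ffun 'I_k.+1 -> T} :=
  [ffun i => if unlift ord0 i is Some j then n j else a].

Definition fftail (n : {ffun 'I_k.+1 -> T}) : {ffun 'I_k -> T} :=
  [ffun i => n (lift ord0 i)].

Lemma ffcons0 a n : ffcons a n ord0 = a.
Proof. by rewrite ffunE unlift_none. Qed.

Lemma ffconsS a n i : ffcons a n (lift ord0 i) = n i.
Proof. by rewrite ffunE liftK. Qed.

Lemma fftail_cons a n : fftail (ffcons a n) = n.
Proof. by apply/ffunP => i; rewrite ffunE ffconsS. Qed.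

Lemma ffcons_eta (n : {ffun 'I_k.+1 -> T}) : ffcons (n ord0) (fftail n) = n.
Proof.
by apply/ffunP => i; rewrite ffunE; case: unliftP => [j|] -> //; rewrite ffunE.
Qed.

End FfunCons.

Lemma sum_ffcons (V : nmodType) k (T : finType) (P : pred {ffun 'I_k.+1 -> T})
    (F : {ffun 'I_k.+1 -> T} -> V) :
  \sum_(n | P n) F n = \sum_a \sum_(n | P (ffcons a n)) F (ffcons a n).
Proof.
rewrite pair_big_dep /=.
rewrite (reindex (fun p : T * {ffun 'I_k -> T} => ffcons p.1 p.2)) //=.
exists (fun n : {ffun 'I_k.+1 -> T} => (n ord0, fftail n)) => [[a n]|n] _ /=.
  by rewrite ffcons0 fftail_cons.
by rewrite ffcons_eta.
Qed.

Section Lattice.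
Variable R : realType.
Implicit Types (k K : nat) (y : R).

(** The volume of the part of the unit ball with nonnegative coordinates,
    obtained by slicing along one coordinate after the other. *)
Definition ball_coef k : R := \prod_(i < k) wallis R i.

Lemma ball_coef_bounds k : 0 <= ball_coef k <= 1.
Proof.
apply/andP; split.
  by apply: prodr_ge0 => i _; case/andP: (wallis_bounds R i).
by apply: prodr_ile1 => i _; exact: wallis_bounds.
Qed.

(** The vectors are confined to a box to make them range over a finite type;
    the bound [K] has no influence on the value as soon as [y <= K%:R]. *)
Definition sublattice_count K k (d : {ffun 'I_k -> nat}) y : R :=
  \sum_(n : {ffun 'I_k -> 'I_K.+1} |
     [forall i, (0 < n i)%N && (d i %| n i)%N] &&
     ((\sum_i n i ^ 2)%N%:R <= y ^+ 2)) 1.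

Lemma sublattice_count0 K (d : {ffun 'I_0 -> nat}) y :
  sublattice_count K d y = 1.
Proof.
rewrite /sublattice_count (bigD1 [ffun=> ord0]) /=; last first.
  by rewrite big_ord0 sqr_ge0 andbT; apply/forallP; case.
rewrite big1 ?addr0 // => n /andP[_ /eqP[]].
by apply/ffunP; case.
Qed.

Lemma sublattice_countS K k (d : {ffun 'I_k.+1 -> nat}) y : 0 <= y ->
  sublattice_count K d y =
  \sum_(a < K.+1 | [&& (0 < a)%N, (d ord0 %| a)%N & a%:R <= y])
    sublattice_count K (fftail d) (Num.sqrt (y ^+ 2 - a%:R ^+ 2)).
Proof.
move=> y0; rewrite /sublattice_count sum_ffcons [RHS]big_mkcond /=.
apply: eq_bigr => a _.
have E (n : {ffun 'I_k -> 'I_K.+1}) :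
    (\sum_i ffcons a n i ^ 2)%N = (a ^ 2 + \sum_i n i ^ 2)%N.
  rewrite big_ord_recl ffcons0; congr addn.
  by apply: eq_bigr => i _; rewrite ffconsS.
have D (n : {ffun 'I_k -> 'I_K.+1}) :
    [forall i, (0 < ffcons a n i)%N && (d i %| ffcons a n i)%N] =
    [&& (0 < a)%N, (d ord0 %| a)%N &
      [forall i, (0 < n i)%N && (fftail d i %| n i)%N]].
  rewrite andbA; apply/forallP/andP => [h|[h0 /forallP h] i].
    split; first by have := h ord0; rewrite ffcons0.
    apply/forallP => i; have := h (lift ord0 i).
    by rewrite ffconsS ffunE.
  case: (unliftP ord0 i) => [j ->|->]; last by rewrite ffcons0.
  by have := h j; rewrite ffconsS ffunE.
case: ifP => [/and3P[a0 da ay]|/negbT].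
  apply: eq_bigl => n; rewrite D E a0 da /=; congr andb.
  rewrite sqr_sqrtr; last by rewrite subr_ge0 lerXn2r ?nnegrE.
  by rewrite natrD natrX lerBrDl.
rewrite !negb_and => h; rewrite big1 // => n; rewrite D E.
case/andP => /and3P[a0 da _]; move: h; rewrite a0 da /= => h1 h2.
case/negP: h1; rewrite -(@ler_pXn2r _ 2) ?nnegrE //.
by apply: le_trans h2; rewrite natrD natrX lerDl ler0n.
Qed.


(** The multiples of [d] in [1, y] are [d, 2 d, .., M d], where [M] is the
    integer part of [y / d]. *)
Lemma sum_multiples (V : nmodType) K (d M : nat) y (f : nat -> V) :
  (0 < d)%N -> y <= K%:R -> M%:R * d%:R <= y < M.+1%:R * d%:R ->
  \sum_(a < K.+1 | [&& (0 < a)%N, (d %| a)%N & a%:R <= y]) f a =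
  \sum_(m < M) f (m.+1 * d)%N.
Proof.
move=> d0 yK /andP[My yM].
rewrite -(big_mkord (fun a => [&& (0 < a)%N, (d %| a)%N & a%:R <= y]) f).
rewrite -(big_mkord predT (fun m => f (m.+1 * d)%N)).
rewrite -big_filter -(big_map (fun m => (m.+1 * d)%N) predT).
apply: perm_big; apply: uniq_perm.
- by rewrite filter_uniq ?iota_uniq.
- rewrite map_inj_uniq ?iota_uniq // => m n /eqP.
  by rewrite eqn_pmul2r // eqSS => /eqP.
move=> a; rewrite mem_filter mem_index_iota /=.
apply/andP/mapP => [[/and3P[a0 /dvdnP[[|m] aE] ay] aK]|[m]].
- by rewrite aE in a0.
- exists m => //; rewrite mem_index_iota /=.
  rewrite -ltnS -(ltr_nat R) -(@ltr_pM2r _ d%:R) ?ltr0n //.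
  by apply: le_lt_trans yM; rewrite -natrM -aE.
rewrite mem_index_iota /= => mM ->.
have h : (m.+1 * d)%:R <= y.
  by apply: le_trans My; rewrite natrM ler_pM2r ?ltr0n // ler_nat.
have hK : (m.+1 * d <= K)%N by rewrite -(ler_nat R) (le_trans h).
by rewrite h dvdn_mull // muln_gt0 d0.
Qed.

Definition vprod k (d : {ffun 'I_k -> nat}) : R := \prod_i (d i)%:R.
Definition vsum k (d : {ffun 'I_k -> nat}) : R := \sum_i (d i)%:R.

Lemma vprodS k (d : {ffun 'I_k.+1 -> nat}) :
  vprod d = (d ord0)%:R * vprod (fftail d).
Proof.
rewrite /vprod big_ord_recl; congr (_ * _).
by apply: eq_bigr => i _; rewrite ffunE.
Qed.

Lemma vsumS k (d : {ffun 'I_k.+1 -> nat}) :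
  vsum d = (d ord0)%:R + vsum (fftail d).
Proof.
rewrite /vsum big_ord_recl; congr (_ + _).
by apply: eq_bigr => i _; rewrite ffunE.
Qed.

Lemma vprod_gt0 k (d : {ffun 'I_k -> nat}) : posvec d -> 0 < vprod d.
Proof. by move=> d0; apply: prodr_gt0 => i _; rewrite ltr0n. Qed.

Lemma vsum_ge0 k (d : {ffun 'I_k -> nat}) : 0 <= vsum d.
Proof. exact: sumr_ge0. Qed.

(** Induction on the dimension.  The slice at height [m.+1 * d ord0] has radius
    [y * r m], and the sum over [m] of [r m ^+ k] is estimated by
    [wallis_riemann].  Replacing this sum by the integral costs one step, that
    is the term of [vsum d] coming from [d ord0]; the error terms of the [M]
    slices, with [M <= y / d ord0], account for the other terms of [vsum d]. *)
Lemma sublattice_count_bounds K k (d : {ffun 'I_k -> nat}) y :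
    posvec d -> 0 <= y <= K%:R ->
  ball_coef k * y ^+ k / vprod d - y ^+ k.-1 * vsum d / vprod d <=
    sublattice_count K d y <= ball_coef k * y ^+ k / vprod d.
Proof.
elim: k d y => [|k IH] d y d_pos /andP[y0 yK].
  rewrite sublattice_count0 /ball_coef /vprod /vsum !big_ord0.
  by rewrite expr0 !mul1r !mul0r subr0 invr1 lexx.
have P0 := vprod_gt0 d_pos.
(* A slice may have radius 0, when the step [D / y] below is meaningless. *)
have [y_eq0|yN0] := eqVneq y 0.
  rewrite sublattice_countS // y_eq0 big_pred0; last first.
    by move=> a; rewrite lern0; case: (a : nat) => [|?] //=; rewrite andbF.
  rewrite expr0n mulr0 mul0r lexx andbT sub0r oppr_le0.
  by rewrite !mulr_ge0 ?exprn_ge0 ?invr_ge0 ?vsum_ge0 ?(ltW P0).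
have {y0 yN0} y0 : 0 < y by rewrite lt_neqAle eq_sym yN0.
pose d' := fftail d.
have d'_pos : posvec d' by move=> i; rewrite ffunE.
have P'0 := vprod_gt0 d'_pos.
have S'0 := vsum_ge0 d'.
pose D : R := (d ord0)%:R.
have D0 : 0 < D by rewrite ltr0n.
pose M := Num.truncn (y / D).
have /andP[M1 M2] : M%:R <= y / D < M.+1%:R.
  by apply: Num.Theory.truncn_itv; rewrite divr_ge0 // ltW.
rewrite ler_pdivlMr // in M1; rewrite ltr_pdivrMr // in M2.
rewrite sublattice_countS ?(ltW y0) //.
rewrite (@sum_multiples _ K (d ord0) M y
  (fun a => sublattice_count K d' (Num.sqrt (y ^+ 2 - a%:R ^+ 2)))) //;
  last by rewrite M1.
pose h := D / y.
have h0 : 0 < h by rewrite divr_gt0.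
pose r m := Num.sqrt (1 - (m.+1%:R * h) ^+ 2).
have mh m : (m < M)%N -> m.+1%:R * h <= 1.
  move=> mM; rewrite mulrA ler_pdivrMr // mul1r (le_trans _ M1) //.
  by rewrite ler_pM2r // ler_nat.
have rE m : (m < M)%N -> Num.sqrt (y ^+ 2 - (m.+1 * d ord0)%:R ^+ 2) = y * r m.
  move=> mM; rewrite -{2}(ger0_norm (ltW y0)) -sqrtr_sqr -sqrtrM ?sqr_ge0 //.
  congr Num.sqrt; rewrite natrM -/D /h.
  by field; rewrite gt_eqF.
have r0 m : 0 <= r m by exact: sqrtr_ge0.
have r1 m : (m < M)%N -> r m <= 1.
  by move=> mM; rewrite -[leRHS]sqrtr1 ler_wsqrtr // gerDl oppr_le0 sqr_ge0.
pose T1 := \sum_(m < M) r m ^+ k.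
have /andP[T1lo T1up] : wallis R k - h <= h * T1 <= wallis R k.
  apply: wallis_riemann => //; rewrite /h !mulrA ler_pdivrMr // mul1r M1.
  by rewrite ltr_pdivlMr // mul1r.
pose c := ball_coef k.
have /andP[c0 c1] : 0 <= c <= 1 by exact: ball_coef_bounds.
have cS : ball_coef k.+1 = c * wallis R k by rewrite /ball_coef big_ord_recr.
have PE : vprod d = D * vprod d' by exact: vprodS.
have SE : vsum d = D + vsum d' by exact: vsumS.
have IHm m : (m < M)%N ->
    c * y ^+ k / vprod d' * r m ^+ k - y ^+ k.-1 * vsum d' / vprod d' <=
    sublattice_count K d' (y * r m) <= c * y ^+ k / vprod d' * r m ^+ k.
  move=> mM; have yr : 0 <= y * r m <= y.
    by rewrite mulr_ge0 ?(ltW y0) //= ler_piMr ?r1 ?(ltW y0).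
  have /andP[yr0 yry] := yr.
  have yrK : 0 <= y * r m <= K%:R by rewrite yr0 (le_trans yry).
  have /andP[lo up] := IH d' (y * r m) d'_pos yrK.
  apply/andP; split.
    apply: le_trans lo; rewrite -/c exprMn; apply: lerB.
      by rewrite mulrA mulrAC.
    rewrite ler_pM2r ?invr_gt0 // ler_wpM2r // lerXn2r ?nnegrE // ?(ltW y0) //.
  by apply: (le_trans up); rewrite -/c exprMn mulrA mulrAC.
have P'N0 : vprod d' != 0 by rewrite gt_eqF.
have DN0 : D != 0 by rewrite gt_eqF.
have yN0 : y != 0 by rewrite gt_eqF.
have cy0 : 0 <= c * y ^+ k / vprod d'.
  by rewrite !mulr_ge0 ?exprn_ge0 ?invr_ge0 ?(ltW y0) ?(ltW P'0).
have sE : \sum_(m < M)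
    sublattice_count K d' (Num.sqrt (y ^+ 2 - (m.+1 * d ord0)%:R ^+ 2)) =
    \sum_(m < M) sublattice_count K d' (y * r m).
  by apply: eq_bigr => m _; rewrite rE.
rewrite sE; apply/andP; split; last first.
  apply: (@le_trans _ _ (c * y ^+ k / vprod d' * T1)).
    rewrite /T1 mulr_sumr; apply: ler_sum => m _.
    by case/andP: (IHm m (ltn_ord m)).
  have -> : ball_coef k.+1 * y ^+ k.+1 / vprod d =
      c * y ^+ k / vprod d' * (wallis R k / h).
    by rewrite cS PE exprS /h; field; apply/and3P.
  by rewrite ler_wpM2l // ler_pdivlMr // mulrC.
apply: (@le_trans _ _ (c * y ^+ k / vprod d' * T1 -
    M%:R * (y ^+ k.-1 * vsum d' / vprod d'))); last first.
  rewrite /T1 mulr_sumr mulr_natl -[X in _ *+ X]card_ord -sumr_const -sumrB.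
  apply: ler_sum => m _.
  by case/andP: (IHm m (ltn_ord m)).
have T1lo' : c * y ^+ k / vprod d' * ((wallis R k - h) / h) <=
    c * y ^+ k / vprod d' * T1.
  by rewrite ler_wpM2l // ler_pdivrMr // [T1 * _]mulrC.
have yk0 : 0 < y ^+ k by rewrite exprn_gt0.
(* If [k = 0] then [k.-1 = 0] and the powers do not match, but [vsum d' = 0]. *)
have yE : y * (y ^+ k.-1 * vsum d') = y ^+ k * vsum d'.
  case: (k) (d') => [|n] e /=.
    by rewrite /vsum big_ord0 !mulr0.
  by rewrite mulrA -exprS.
have Mle : M%:R * (y ^+ k.-1 * vsum d' / vprod d') <=
    y ^+ k * vsum d' / (D * vprod d').
  rewrite -yE.
  have -> : y * (y ^+ k.-1 * vsum d') / (D * vprod d') =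
      (y / D) * (y ^+ k.-1 * vsum d' / vprod d').
    by field; apply/andP.
  apply: ler_wpM2r; last by rewrite ler_pdivlMr.
  by rewrite !mulr_ge0 ?exprn_ge0 ?invr_ge0 ?(ltW y0) ?(ltW P'0).
have cle : c * y ^+ k / vprod d' <= y ^+ k / vprod d'.
  by rewrite ler_pM2r ?invr_gt0 // ler_piMl // ltW.
apply: le_trans (lerB T1lo' Mle).
have -> : ball_coef k.+1 * y ^+ k.+1 / vprod d - y ^+ k * vsum d / vprod d =
  c * y ^+ k / vprod d' * (wallis R k / h) - y ^+ k / vprod d' -
    y ^+ k * vsum d' / (D * vprod d').
  by rewrite cS PE SE exprS /h; field; apply/and3P.
have -> : c * y ^+ k / vprod d' * ((wallis R k - h) / h) =
  c * y ^+ k / vprod d' * (wallis R k / h) - c * y ^+ k / vprod d'.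
  by field; rewrite P'N0 gt_eqF.
by rewrite lerD2r lerD2l lerN2.
Qed.
End Lattice.

(** * The volume of the unit ball *)

Section GaussMoments.
Variable R : realType.
Implicit Types (n : nat) (x : R).
Local Notation mu := (@lebesgue_measure R).

Lemma Rintegral_FTC (f F : R -> R) (a b : R) : a < b -> continuous f ->
  (forall x, is_derive x 1 F (f x)) ->
  \int[mu]_(x in `[a, b]) f x = F b - F a.
Proof.
move=> ab cf dF; have cF : continuous F.
  move=> x; apply: differentiable_continuous; apply/derivable1_diffP.
  exact: ex_derive.
rewrite /Rintegral (@continuous_FTC2 _ f F) //.
- exact: continuous_subspaceT.
- split; first by move=> x _; exact: ex_derive.
    exact/cvg_at_right_filter/cF.
  exact/cvg_at_left_filter/cF.
- by move=> x _; rewrite derive1E; exact: derive_val.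
Qed.

Definition gauss_monom n x := x ^+ n * expR (- x ^+ 2).

Lemma is_derive_gauss_monom n x :
  is_derive x 1 (gauss_monom n)
    (n%:R * gauss_monom n.-1 x - 2 * gauss_monom n.+1 x).
Proof.
rewrite (_ : gauss_monom n =
    (id ^+ n : R -> R) * (expR \o (fun z => - z ^+ 2))); last first.
  by apply/funext => z; rewrite /gauss_monom !fctE.
apply: is_derive_eq.
rewrite /GRing.scale /= exprfctE !mulr1 /gauss_monom.
by rewrite (exprS x n); move: (expR _) (x ^+ n) (x ^+ n.-1) => e u v; ring.
Qed.

Lemma continuous_gauss_monom n : continuous (gauss_monom n).
Proof.
move=> x; apply: differentiable_continuous; apply/derivable1_diffP.
have h := is_derive_gauss_monom n x; exact: ex_derive.
Qed.

(** The exponential series gives [x ^+ (2 * n.+1) / n.+1`!%:R] as a lower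
    bound of [expR (x ^+ 2)]. *)
Lemma cvg_gauss_monom n : gauss_monom n x @[x --> +oo] --> (0 : R).
Proof.
apply: (@squeeze_cvgr _ _ _ _ (cst 0) (fun x => (n.+1)`!%:R / x)).
- near=> x.
  have x1 : 1 <= x by near: x; exact: nbhs_pinfty_ge.
  have x0 : 0 < x by lra.
  have f0 : 0 < (n.+1)`!%:R :> R by rewrite ltr0n fact_gt0.
  rewrite /gauss_monom mulr_ge0 ?expR_ge0 ?exprn_ge0 ?(ltW x0) //=.
  rewrite expRN ler_pdivrMr ?expR_gt0 // mulrAC ler_pdivlMr // -exprSr.
  have := @expR_ge1Dxn R (x ^+ 2) n (sqr_ge0 _).
  rewrite -exprM => h.
  have {h} : (x ^+ (2 * n.+1)) / n.+1`!%:R <= expR (x ^+ 2) by lra.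
  rewrite ler_pdivrMr // mulrC; apply: le_trans.
  by rewrite ler_weXn2l //; lia.
- exact: cvg_cst.
- rewrite -[X in _ --> X](mulr0 ((n.+1)`!%:R : R)); apply: cvgMl_tmp.
  by apply/gtr0_cvgV0 => //; exact: nbhs_pinfty_gt.
Unshelve. all: by end_near. Qed.

Definition gauss_moment_upto n x : R := \int[mu]_(v in `[0, x]) gauss_monom n v.

(** The integral of [gauss_monom n] over the half line, computed by parts
    (see [cvg_gauss_moment]). *)
Fixpoint gauss_moment n : R :=
  match n with
  | 0 => Num.sqrt pi / 2
  | 1 => 1 / 2
  | n'.+2 => n'.+1%:R / 2 * gauss_moment n'
  end.

Lemma integrable_gauss_monom n x :
  mu.-integrable `[0, x] (EFin \o gauss_monom n).
Proof.
apply: continuous_compact_integrable; first exact: segment_compact.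
exact/continuous_subspaceT/continuous_gauss_monom.
Qed.

Lemma gauss_moment_uptoS n x : 0 < x ->
  2 * gauss_moment_upto n.+1 x =
  n%:R * gauss_moment_upto n.-1 x + gauss_monom n 0 - gauss_monom n x.
Proof.
move=> x0.
have cZ m (c : R) : continuous (fun v => c * gauss_monom m v).
  by move=> v; apply: cvgMl_tmp; exact: continuous_gauss_monom.
have iZ m (c : R) :
    mu.-integrable `[0, x] (EFin \o (fun v => c * gauss_monom m v)).
  apply: continuous_compact_integrable; first exact: segment_compact.
  exact: continuous_subspaceT.
have := @Rintegral_FTC _ _ 0 x x0 _ (is_derive_gauss_monom n).
rewrite RintegralB // !RintegralZl //; try exact: integrable_gauss_monom.
rewrite -!/(gauss_moment_upto _ x).
set u := 2 * _; set v := n%:R * _ => h.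
suff : v - u = gauss_monom n x - gauss_monom n 0 by lra.
by apply: h => z; apply: cvgB; exact: cZ.
Qed.

Lemma cvg_gauss_moment n :
  gauss_moment_upto n x @[x --> +oo] --> gauss_moment n.
Proof.
suff: gauss_moment_upto n x @[x --> +oo] --> gauss_moment n /\
  gauss_moment_upto n.+1 x @[x --> +oo] --> gauss_moment n.+1 by case.
elim: n => [|n [IH0 IH1]].
  split; last first.
    have near1 : \forall x \near +oo,
        2^-1 * (1 - gauss_monom 0 x) = gauss_moment_upto 1 x.
      near=> x; have x0 : 0 < x by near: x; exact: nbhs_pinfty_gt.
      have := gauss_moment_uptoS 0 x0; rewrite mul0r add0r.
      have -> : gauss_monom 0 0 = 1.
        by rewrite /gauss_monom expr0 expr0n /= oppr0 expR0 mulr1.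
      lra.
    apply: cvg_trans (near_eq_cvg near1) _.
    rewrite (_ : gauss_moment 1 = 2^-1 * (1 - 0)); last by rewrite /=; lra.
    apply: cvgMl_tmp.
    by apply: cvgB; [exact: cvg_cst | exact: cvg_gauss_monom].
  have E : Num.sqrt (gauss_integral_proof.integral0_gauss x ^+ 2) @[x --> +oo]
      --> Num.sqrt (pi / 4 : R).
    apply: continuous_cvg; first exact: sqrt_continuous.
    exact: gauss_integral_proof.cvg_integral0_gauss_sqr.
  rewrite /= (_ : Num.sqrt pi / 2 = Num.sqrt (pi / 4 : R)); last first.
    rewrite sqrtrM ?pi_ge0// sqrtrV// (_ : 4 = 2 ^+ 2); last first.
      by rewrite expr2 -natrM.
    by rewrite sqrtr_sqr ger0_norm.
  rewrite (_ : (fun x => _) = (fun x => gauss_moment_upto 0 x)) // in E.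
  apply/funext => x; rewrite sqrtr_sqr ger0_norm;
    last exact: gauss_integral_proof.integral0_gauss_ge0.
  by apply: eq_Rintegral => v _; rewrite /gauss_monom expr0 mul1r.
split => //.
have nearS : \forall x \near +oo,
    2^-1 * (n.+1%:R * gauss_moment_upto n x - gauss_monom n.+1 x) =
    gauss_moment_upto n.+2 x.
  near=> x; have x0 : 0 < x by near: x; exact: nbhs_pinfty_gt.
  have := gauss_moment_uptoS n.+1 x0.
  have -> : gauss_monom n.+1 0 = 0 by rewrite /gauss_monom expr0n mul0r.
  rewrite /=; lra.
apply: cvg_trans (near_eq_cvg nearS) _.
rewrite (_ : gauss_moment n.+2 =
    2^-1 * (n.+1%:R * gauss_moment n - 0)); last first.
  by rewrite /=; lra.
apply: cvgMl_tmp; apply: cvgB; last exact: cvg_gauss_monom.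
exact: cvgMl_tmp.
Unshelve. all: by end_near. Qed.

End GaussMoments.

Section GammaHalf.
Variable R : realType.
Local Notation mu := (@lebesgue_measure R).

Let g k (u : R) : R := Num.sqrt u ^+ k * expR (- u).

Let continuous_g k : continuous (g k).
Proof.
move=> u; apply: cvgM.
  apply: (@continuous_comp _ _ _ Num.sqrt (fun z : R => z ^+ k)).
    exact: sqrt_continuous.
  exact: exprn_continuous.
apply: (@continuous_comp _ _ _ -%R expR).
  exact: opp_continuous.
exact: continuous_expR.
Qed.

(** The substitution [u = v ^+ 2], on a bounded interval because its derivative
    is unbounded on the half line. *)
Lemma integral_sqrt_expR k (x : R) : 0 <= x ->
  (\int[mu]_(u in `[0%R, (x ^+ 2)%R]) (g k u)%:E =
   (2 * gauss_moment_upto k.+1 x)%R%:E)%E.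
Proof.
move=> x0.
have dsq (v : R) : is_derive v 1 (fun z : R => z ^+ 2) (2 * v).
  by apply: is_derive_eq; rewrite /GRing.scale /= !mulr1 mulr2n mulrDl mul1r.
have dsqE : derive1 (fun z : R => z ^+ 2) = (fun v => 2 * v).
  by apply/funext => v; rewrite derive1E; exact: derive_val.
have c2 : continuous (fun v : R => 2 * v).
  by move=> v; apply: cvgMl_tmp; exact: cvg_id.
have := @integration_by_substitution_increasing R
  (fun z : R => z ^+ 2) (g k) 0 x x0.
rewrite expr0n /= => ->.
- rewrite dsqE /gauss_moment_upto /Rintegral.
  rewrite EFinM fineK; last first.
    apply: integrable_fin_num => //; exact: integrable_gauss_monom.
  rewrite -integralZl //; last exact: integrable_gauss_monom.
  apply: eq_integral => v /set_mem; rewrite /= in_itv /= => /andP[v0 _].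
  rewrite -EFinM; congr EFin.
  rewrite /g /gauss_monom !fctE /= sqrtr_sqr ger0_norm //.
  rewrite (exprSr v k); move: (expR _) (v ^+ k) => e w.
  by ring.
- move=> a b; rewrite !in_itv /= => /andP[a0 _] /andP[b0 _] ab.
  by rewrite ltrXn2r ?nnegrE.
- by rewrite dsqE => v _; exact: c2.
- by rewrite dsqE; apply/cvg_ex; exists (2 * 0); apply/cvg_at_right_filter/c2.
- by rewrite dsqE; apply/cvg_ex; exists (2 * x); apply/cvg_at_left_filter/c2.
- split; first by move=> v _; exact: ex_derive.
    exact/cvg_at_right_filter/exprn_continuous.
  exact/cvg_at_left_filter/exprn_continuous.
- exact/continuous_subspaceT/continuous_g.
Qed.

(** [integral_sqrt_expR] at [x = Num.sqrt n%:R], as [n] tends to infinity. *)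
Lemma Gamma_half k : Gamma (k%:R / 2 + 1) = 2 * gauss_moment R k.+1.
Proof.
have mg : measurable_fun setT (g k).
  by apply: continuous_measurable_fun; exact: continuous_g.
have g0 u : 0 <= g k u by rewrite mulr_ge0 ?expR_ge0 ?exprn_ge0.
rewrite /Gamma addrK /Rintegral.
have -> : (\int[mu]_(u in `]0%R, +oo[) (u `^ (k%:R / 2) * expR (- u))%R%:E =
    \int[mu]_(u in `[0%R, +oo[) (g k u)%:E)%E.
  rewrite -integral_itv_obnd_cbnd; last first.
    by apply/measurable_EFinP/measurable_funTS.
  apply: eq_integral => u /set_mem; rewrite /= in_itv /= andbT => u0.
  by rewrite /g [k%:R / 2]mulrC powRrM powR12_sqrt ?powR_mulrn // ltW.
have h1 := @ge0_cvgn_integral R mu _ g0 mg.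
have h2 : (\int[mu]_(u in `[0%R, n%:R]) (g k u)%:E)%E @[n --> \oo] -->
    (2 * gauss_moment R k.+1)%:E.
  rewrite (_ : (fun n => _) =
    (fun n => (2 * gauss_moment_upto k.+1 (Num.sqrt n%:R))%:E)); last first.
    by apply/funext => n; rewrite -integral_sqrt_expR // sqr_sqrtr.
  apply: cvg_EFin; first exact: nearW.
  apply: cvgMl_tmp.
  have /cvg_pinftyP := @cvg_gauss_moment R k.+1; apply.
  apply/cvgryPge => r; near=> n.
  have n0 : 0 < n%:R :> R by rewrite ltr0n; near: n; exact: nbhs_infty_gt.
  apply: (@le_trans _ _ (Num.sqrt (r ^+ 2))).
    by rewrite sqrtr_sqr ler_norm.
  rewrite ler_sqrt //; near: n; exact: nbhs_infty_ger.
by have -> := cvg_unique _ h1 h2.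
Unshelve. all: by end_near. Qed.

(** Both sides are multiplied by [pi / 2 / k.+2%:R] when [k] increases by 2: the
    left one by the recursion of [gauss_moment], the right one by
    [wallis_mul]. *)
Lemma unit_ball_volumeE k : unit_ball_volume R k / 2 ^+ k = ball_coef R k.
Proof.
pose v j : R := Num.sqrt pi ^+ j / (2 * gauss_moment R j.+1) / 2 ^+ j.
have p0 := pi_gt0 R.
have sp0 : Num.sqrt (pi : R) != 0 by rewrite gt_eqF // sqrtr_gt0.
have -> : unit_ball_volume R k / 2 ^+ k = v k.
  rewrite /unit_ball_volume Gamma_half /v.
  rewrite [k%:R / 2]mulrC powRrM powR12_sqrt ?pi_ge0 //.
  by rewrite powR_mulrn ?sqrtr_ge0.
have mS j : gauss_moment R j.+3 = j.+2%:R / 2 * gauss_moment R j.+1 by [].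
have m0 j : gauss_moment R j.+1 != 0.
  suff /andP[] : (gauss_moment R j.+1 != 0) && (gauss_moment R j.+2 != 0) by [].
  elim: j => [|j /andP[h1 h2]].
    by rewrite /= !mulf_neq0 ?invr_neq0 ?oner_neq0.
  by rewrite h2 mS !mulf_neq0 ?invr_neq0 ?pnatr_eq0.
have vS j : v j.+2 = v j * (pi / 2 / j.+2%:R).
  have h : j.+2%:R != 0 :> R by rewrite pnatr_eq0.
  have e2 : 2 ^+ j != 0 :> R by rewrite expf_neq0.
  have se : Num.sqrt pi ^+ j.+2 = Num.sqrt pi ^+ j * pi :> R.
    by rewrite -addn2 exprD sqr_sqrtr ?pi_ge0.
  rewrite /v mS se -[j.+2]addn2 exprD [(j + 2)%N]addn2.
  have := m0 j.
  move: (gauss_moment R j.+1) (j.+2%:R : R) (2 ^+ j : R) h e2 => m z e h e2 h3.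
  by field; rewrite e2 h3 h.
have bS j : ball_coef R j.+2 = ball_coef R j * (pi / 2 / j.+2%:R).
  rewrite -wallis_mul /ball_coef !big_ord_recr /=.
  by rewrite [wallis R j.+1 * _]mulrC mulrA.
suff /andP[/eqP] : (v k == ball_coef R k) && (v k.+1 == ball_coef R k.+1) by [].
elim: k => [|k /andP[/eqP h1 h2]]; last by rewrite h2 vS bS h1 eqxx.
rewrite /ball_coef big_ord_recl !big_ord0 /v /= /wallis /= sin_pihalf.
apply/andP; split; apply/eqP; first by field.
by rewrite !expr1; field.
Qed.

End GammaHalf.

(** * Moebius inversion *)

Section Moebius.
Implicit Types (p e n m d : nat).

Lemma moebius_prime_mul_dvd p e : prime p -> (0 < e)%N -> (p %| e)%N ->
  moebius (p * e) = 0.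
Proof.
move=> pp e0 pe; have p0 := prime_gt0 pp.
rewrite /moebius ifF //; apply/negP => /allP /(_ p).
rewrite primesM // primes_prime // mem_seq1 eqxx => /(_ isT).
rewrite lognM // logn_prime // eqxx eqSS -leqn0 leqNgt logn_gt0.
by rewrite mem_primes pp e0 pe.
Qed.

Lemma moebius_prime_mul_ndvd p e : prime p -> (0 < e)%N -> ~~ (p %| e)%N ->
  moebius (p * e) = - moebius e.
Proof.
move=> pp e0 pe; have p0 := prime_gt0 pp.
have pNe : p \notin primes e by rewrite mem_primes pp e0 (negbTE pe).
have pE : perm_eq (primes (p * e)) (p :: primes e).
  apply: uniq_perm; rewrite ?primes_uniq //= ?pNe ?primes_uniq // => q.
  by rewrite primesM // primes_prime // mem_seq1 inE.
have lE q : q \in primes e -> logn q (p * e) = logn q e.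
  move=> qe; rewrite lognM // logn_prime //.
  by case: eqP qe pNe => [->->|].
rewrite /moebius (perm_all _ pE) (perm_size pE) /=.
have -> : logn p (p * e) == 1%N.
  rewrite lognM // logn_prime // eqxx -[X in _ == X]addn0 eqn_add2l.
  by rewrite -leqn0 leqNgt logn_gt0.
rewrite /= (eq_in_all (a2 := fun q => logn q e == 1%N)); last first.
  by move=> q /lE ->.
by case: ifP => _; rewrite ?oppr0 // exprS mulN1r.
Qed.

(** If a prime [p] divides [n], the squarefree divisors of [n] come in pairs
    [d], [p * d] of opposite signs. *)
Lemma sum_moebius_divisors n : (0 < n)%N ->
  \sum_(d <- divisors n) moebius d = (n == 1%N)%:R.
Proof.
move=> n0; have [->|n1] := eqVneq n 1%N.
  by rewrite (_ : divisors 1 = [:: 1%N]) // big_seq1.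
have n1' : (1 < n)%N by case: n n0 n1 => [|[]].
pose p := pdiv n; have pp : prime p by exact: pdiv_prime.
have p0 := prime_gt0 pp.
have pn : (p %| n)%N by exact: pdiv_dvd.
have np0 : (0 < n %/ p)%N by rewrite divn_gt0 // dvdn_leq.
rewrite (bigID (fun d => p %| d)%N) /=.
rewrite -[X in X + _]big_filter.
have P1 : perm_eq [seq d <- divisors n | (p %| d)%N]
                  [seq (p * e)%N | e <- divisors (n %/ p)].
  apply: uniq_perm; first by rewrite filter_uniq // divisors_uniq.
    rewrite map_inj_uniq ?divisors_uniq // => a b /eqP.
    by rewrite eqn_pmul2l // => /eqP.
  move=> d; rewrite mem_filter -dvdn_divisors //.
  apply/andP/mapP => [[/dvdnP[e ->] epn]|[e]].
    exists e; last by rewrite mulnC.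
    by rewrite -dvdn_divisors // dvdn_divRL // .
  rewrite -dvdn_divisors // => en ->; rewrite dvdn_mulr //.
  by rewrite mulnC -dvdn_divRL.
rewrite (perm_big _ P1) big_map.
rewrite (bigID (fun d => p %| d)%N) /= big_seq_cond big1 ?add0r; last first.
  move=> e; rewrite -dvdn_divisors // => /andP[en pe].
  by rewrite moebius_prime_mul_dvd // (dvdn_gt0 np0).
rewrite [X in X + _]big_seq_cond.
under eq_bigr => e /andP[en pe].
  rewrite moebius_prime_mul_ndvd //; last first.
    by move: en; rewrite -dvdn_divisors //; exact: dvdn_gt0.
  over.
rewrite -big_seq_cond sumrN -[X in - X + _]big_filter.
suff P2 : perm_eq [seq d <- divisors (n %/ p) | ~~ (p %| d)%N]
                  [seq d <- divisors n | ~~ (p %| d)%N].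
  by rewrite (perm_big _ P2) big_filter addNr.
apply: uniq_perm; rewrite ?filter_uniq ?divisors_uniq // => d.
rewrite !mem_filter -!dvdn_divisors //; case: (boolP (p %| d)%N) => //= pd.
by rewrite -[in RHS](divnK pn) Gauss_dvdl // coprime_sym prime_coprime.
Qed.

(** The quotients [d %/ m] run through the divisors of [n %/ m]. *)
Lemma sum_moebius_between K m n : (0 < n <= K)%N -> (m %| n)%N ->
  \sum_(d < K.+1 | (m %| d)%N && (d %| n)%N) moebius (d %/ m) = (n == m)%:R.
Proof.
move=> /andP[n0 nK] mn; have m0 := dvdn_gt0 n0 mn.
have nm0 : (0 < n %/ m)%N by rewrite divn_gt0 // dvdn_leq.
rewrite -(big_mkord (fun d => (m %| d)%N && (d %| n)%N)
  (fun d => moebius (d %/ m))).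
rewrite -big_filter.
rewrite (perm_big [seq (m * e)%N | e <- divisors (n %/ m)]); last first.
  apply: uniq_perm; first by rewrite filter_uniq // iota_uniq.
    rewrite map_inj_uniq ?divisors_uniq // => a b /eqP.
    by rewrite eqn_pmul2l // => /eqP.
  move=> d; rewrite mem_filter mem_index_iota /=.
  apply/andP/mapP => [[/andP[/dvdnP[e ->] emn] _]|[e]].
    exists e; last by rewrite mulnC.
    by rewrite -dvdn_divisors // dvdn_divRL.
  rewrite -dvdn_divisors // => en ->; rewrite dvdn_mulr //=.
  have h : (m * e %| n)%N by rewrite mulnC -dvdn_divRL.
  by rewrite h; split=> //; rewrite ltnS (leq_trans (dvdn_leq n0 h)).
rewrite big_map; under eq_bigr do rewrite mulKn //.
by rewrite sum_moebius_divisors // -(eqn_pmul2r m0) divnK // mul1n.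
Qed.

End Moebius.

Section Box.
Variables (k K : nat).
Local Notation vec := {ffun 'I_k -> nat}.
Local Notation box := {ffun 'I_k -> 'I_K.+1}.

(** Finite sums over vectors are indexed by boxes: unlike the type of all
    vectors, a box is a finite type. *)
Definition vec_of_box (n : box) : vec := [ffun i => nat_of_ord (n i)].

Lemma vec_of_boxE n i : vec_of_box n i = n i.
Proof. by rewrite ffunE. Qed.

Lemma vec_of_box_inj : injective vec_of_box.
Proof.
move=> m n /ffunP mn; apply/ffunP => i; apply/val_inj.
by have := mn i; rewrite !ffunE.
Qed.

Lemma vec_of_box_surj (d : vec) : (forall i, (d i <= K)%N) ->
  exists n, d = vec_of_box n.
Proof.
move=> dK; exists [ffun i => inord (d i)].
by apply/ffunP => i; rewrite !ffunE inordK // ltnS.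
Qed.

Lemma fsum_box (V : nmodType) (S : set vec) (f : vec -> V) :
  (forall d, S d -> forall i, (d i <= K)%N) ->
  \sum_(d \in S) f d =
  \sum_(n : box | `[< S (vec_of_box n) >]) f (vec_of_box n).
Proof.
move=> SK; rewrite -(big_map vec_of_box (fun d => `[< S d >]) f) /=.
rewrite [RHS]bigfs.
- by apply: eq_fsbigl; apply/seteqP; split => d /=; rewrite asboolE.
- by rewrite (map_inj_uniq vec_of_box_inj) index_enum_uniq.
- move=> d /asboolP /SK /vec_of_box_surj[n ->].
  by rewrite map_f // mem_index_enum.
Qed.

Definition dvdv (d n : box) := [forall i, (d i %| n i)%N].

Variable R : realType.
Local Notation C := (Cplx R).

(** The sum is reindexed by the involution that maps a divisor [d] of [n] to
    the complementary divisor. *)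
Lemma dconv_box (G F : vec -> C) (n : box) : posvec (vec_of_box n) ->
  dconv G F (vec_of_box n) =
  \sum_(d | dvdv d n) G [ffun i => (n i %/ d i)%N] * F (vec_of_box d).
Proof.
move=> n0; rewrite /dconv fsum_box => [|d dn i]; last first.
  have := dvdn_leq (n0 i) (dn i); rewrite ffunE => /leq_trans; apply.
  by rewrite -ltnS.
have {}n0 i : (0 < n i)%N by have := n0 i; rewrite ffunE.
pose h (d : box) : box := [ffun i => inord (n i %/ d i)].
have hE d i : h d i = (n i %/ d i)%N :> nat.
  by rewrite ffunE inordK // (leq_ltn_trans (leq_div _ _)).
rewrite (reindex_onto h h) /=; last first.
  move=> d /asboolP dn; apply/ffunP => i; apply/val_inj; rewrite /= !hE.
  have := dn i; rewrite !ffunE => din.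
  by rewrite divnA // mulKn.
apply: eq_big => [d|d /andP[_ /eqP dE]].
  apply/andP/forallP => [[/asboolP hn /eqP hh] i|dn].
    have := hn i; rewrite !vec_of_boxE => hin.
    by rewrite -hh hE dvdn_div.
  split; first by apply/asboolP => i; rewrite !vec_of_boxE hE dvdn_div.
  by apply/eqP/ffunP => i; apply/val_inj; rewrite /= !hE divnA // mulKn.
congr (G _ * F _); apply/ffunP => i.
  by rewrite vec_of_boxE [RHS]ffunE hE.
by rewrite [LHS]ffunE !vec_of_boxE -[in RHS]dE !hE.
Qed.

(** Exchanging the sums, the coefficient of [F m] in the sum of [mu * F] over
    the divisors of [n] is a product over the coordinates of sums of [mu]. *)
Lemma moebius_inversion (F : vec -> C) (n : box) : posvec (vec_of_box n) ->
  F (vec_of_box n) =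
  \sum_(d | dvdv d n) dconv (@moebiusv R k) F (vec_of_box d).
Proof.
move=> n0; have {}n0 i : (0 < n i)%N by have := n0 i; rewrite ffunE.
have dpos d : dvdv d n -> posvec (vec_of_box d).
  by move=> /forallP dn i; rewrite ffunE (dvdn_gt0 (n0 i)).
under eq_bigr => d dn.
  rewrite dconv_box; last exact: dpos.
  over.
rewrite (exchange_big_dep (fun m => dvdv m n)) /=; last first.
  move=> d m /forallP dn /forallP md; apply/forallP => i.
  exact: dvdn_trans (dn i).
rewrite (bigD1 n) /=; last by apply/forallP => i.
have inner m : dvdv m n ->
    \sum_(d | dvdv d n && dvdv m d) moebiusv R [ffun i => (d i %/ m i)%N] *
      F (vec_of_box m) = (n == m)%:R * F (vec_of_box m).
  move=> /forallP mn; rewrite -mulr_suml; congr (_ * _).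
  transitivity (\prod_i \sum_(a : 'I_K.+1 | (m i %| a)%N && (a %| n i)%N)
      (moebius (a %/ m i))%:~R : C).
    rewrite bigA_distr_big_dep /=; apply: eq_big => [d|d _].
      apply/andP/familyP => [[/forallP dn /forallP md] i|h].
        by rewrite unfold_in /= dn md.
      split; apply/forallP => i; have := h i; rewrite unfold_in /=;
        by case/andP.
    by apply: eq_bigr => i _; rewrite ffunE.
  under eq_bigr => i _.
    rewrite -(rmorph_sum (intr : int -> C)) sum_moebius_between //; last first.
      by rewrite n0 -ltnS /=.
    over.
  have [->|nm] := eqVneq n m.
    by rewrite big1 // => i _; rewrite eqxx.
  case: (pickP (fun i => n i != m i)) => [i ni|nE].
    rewrite (bigD1 i) //= -[nat_of_ord _ == _]/(n i == m i).
    by rewrite (negbTE ni) mul0r.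
  by case/eqP: nm; apply/ffunP => i; have /negbFE/eqP := nE i.
rewrite inner ?eqxx ?mul1r; last by apply/forallP => i.
rewrite big1 ?addr0 // => m /andP[mn mNn].
by rewrite inner // eq_sym (negbTE mNn) mul0r.
Qed.

End Box.

(** * Sums of absolutely convergent multiple series *)

Section Cmod.
Variable R : realType.
Local Notation C := (Cplx R).
Implicit Types z w : C.

Lemma normC_cmod z : `|z| = (cmod z)%:C.
Proof. by rewrite /cmod normc_def. Qed.

Lemma cmod_ge0 z : 0 <= cmod z.
Proof. by rewrite -ler0c -normC_cmod. Qed.

Lemma cmodM z w : cmod (z * w) = cmod z * cmod w.
Proof. by apply: complexI; rewrite rmorphM /= -!normC_cmod normrM. Qed.

Lemma cmodV z : cmod z^-1 = (cmod z)^-1.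
Proof. by apply: complexI; rewrite fmorphV /= -!normC_cmod normfV. Qed.

Lemma gt0_complex_real z : 0 < z -> exists2 r : R, 0 < r & z = r%:C.
Proof.
case: z => a b; rewrite ltcE /= => /andP[/eqP b0 a0].
by exists a => //; rewrite b0.
Qed.

Lemma le_cmodD z w : cmod (z + w) <= cmod z + cmod w.
Proof. by rewrite -lecR rmorphD /= -!normC_cmod ler_normD. Qed.

Lemma cmod_real (x : R) : cmod (x%:C : C) = `|x|.
Proof. by rewrite /cmod normc_def /= expr0n addr0 sqrtr_sqr. Qed.

Lemma cmod0 : cmod (0 : C) = 0.
Proof. by rewrite -[0 in LHS](rmorph0 (real_complex R)) cmod_real normr0. Qed.

Lemma le_cmod_sum (I : Type) (r : seq I) (f : I -> C) :
  cmod (\sum_(i <- r) f i) <= \sum_(i <- r) cmod (f i).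
Proof.
elim/big_rec2: _ => [|i x z _ h]; first by rewrite cmod0.
by apply: le_trans (le_cmodD _ _) _; rewrite lerD2l.
Qed.

Lemma normr_Re_le_cmod z : `|complex.Re z| <= cmod z.
Proof. by rewrite -lecR -normC_cmod normc_ge_Re. Qed.

Lemma normr_Im_le_cmod z : `|complex.Im z| <= cmod z.
Proof.
rewrite /cmod normc_def /= -sqrtr_sqr ler_wsqrtr //.
by rewrite lerDr sqr_ge0.
Qed.

Lemma cmod_le_ReIm z : cmod z <= `|complex.Re z| + `|complex.Im z|.
Proof.
rewrite {1}(complexE z); apply: le_trans (le_cmodD _ _) _.
rewrite cmodM !cmod_real lerD2l.
by rewrite /cmod normc_def /= expr0n add0r expr1n sqrtr1 mul1r.
Qed.

End Cmod.

Section Nets.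
Variables (R : realType) (I : choiceType).
Local Notation C := (Cplx R).

Lemma sum_fset_sub (V : nmodType) (w : I -> V) (A B : {fset I}) :
  (A `<=` B)%fset ->
  \sum_(i <- B) w i = \sum_(i <- A) w i + \sum_(i <- B | i \notin A) w i.
Proof.
move=> AB; rewrite (bigID [in A]) /=; congr (_ + _).
rewrite -big_filter; apply: perm_big; apply: uniq_perm.
- by rewrite filter_uniq ?fset_uniq.
- exact: fset_uniq.
by move=> i; rewrite mem_filter /= andb_idr // => /(fsubsetP AB).
Qed.

Lemma ler_sum_fset (w : I -> R) (A B : {fset I}) : (forall i, 0 <= w i) ->
  (A `<=` B)%fset -> \sum_(i <- A) w i <= \sum_(i <- B) w i.
Proof. by move=> w0 /sum_fset_sub ->; rewrite lerDl sumr_ge0. Qed.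

(** The limit is the supremum of the partial sums. *)
Lemma ge0_net_limit (w : I -> R) (M : R) : (forall i, 0 <= w i) ->
  (forall A : {fset I}, \sum_(i <- A) w i <= M) ->
  exists L, forall e, 0 < e -> exists A0 : {fset I}, forall A : {fset I},
    (A0 `<=` A)%fset -> L - e < \sum_(i <- A) w i <= L.
Proof.
move=> w0 wM.
pose E := [set \sum_(i <- A) w i | A in [set: {fset I}]].
have supE : has_sup E.
  split; last by exists M => _ [A _ <-].
  by exists (\sum_(i <- fset0%fset) w i), fset0%fset.
exists (sup E) => e e0; have [_ [A0 _ <-] h] := sup_adherent e0 supE.
exists A0 => A A0A; rewrite (lt_le_trans h) ?ler_sum_fset //=.
by apply: (ub_le_sup (proj2 supE)); exists A.
Qed.

(** The families [|z| + Re z], [|z| + Im z] and [|z|] are nonnegative with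
    bounded partial sums, so [ge0_net_limit] applies to them; the real and
    imaginary parts are differences of two of them. *)
Lemma complex_net_limit (a : I -> C) (M : R) :
  (forall A : {fset I}, \sum_(i <- A) cmod (a i) <= M) ->
  exists L : C, forall e, 0 < e -> exists A0 : {fset I}, forall A : {fset I},
    (A0 `<=` A)%fset -> cmod (\sum_(i <- A) a i - L) < e.
Proof.
move=> aM.
have part (f : C -> R) : (forall z, `|f z| <= cmod z) ->
    exists L : R, forall e, 0 < e -> exists A0 : {fset I}, forall A : {fset I},
    (A0 `<=` A)%fset -> `|\sum_(i <- A) f (a i) - L| < e.
  move=> fM.
  have [i|A|L1 HL1] := @ge0_net_limit (fun i => cmod (a i) + f (a i)) (M + M).
  - by have := fM (a i); rewrite ler_norml => /andP[? ?]; lra.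
  - rewrite big_split /=; apply: lerD => //; apply: le_trans (aM A).
    by apply: ler_sum => i _; apply: le_trans (fM _); exact: ler_norm.
  have [i|A|L0 HL0] := @ge0_net_limit (fun i => cmod (a i)) M.
  - exact: cmod_ge0.
  - exact: aM.
  exists (L1 - L0) => e e0.
  have [A1 HA1] := HL1 _ e0; have [A0 HA0] := HL0 _ e0.
  exists (A0 `|` A1)%fset => A; rewrite fsubUset.
  move=> /andP[/HA0 /andP[h1 h2] /HA1 /andP[h3 h4]].
  rewrite big_split /= in h3 h4.
  by rewrite ltr_norml; apply/andP; split; lra.
have [L1 HL1] := part _ (@normr_Re_le_cmod R).
have [L2 HL2] := part _ (@normr_Im_le_cmod R).
exists (L1 +i* L2)%C => e e0.
have e2 : 0 < e / 2 by lra.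
have [A1 HA1] := HL1 _ e2; have [A2 HA2] := HL2 _ e2.
exists (A1 `|` A2)%fset => A; rewrite fsubUset => /andP[/HA1 h1 /HA2 h2].
apply: le_lt_trans (cmod_le_ReIm _) _.
have -> : complex.Re (\sum_(i <- A) a i - (L1 +i* L2)%C) =
    \sum_(i <- A) complex.Re (a i) - L1.
  by rewrite raddfB raddf_sum.
have -> : complex.Im (\sum_(i <- A) a i - (L1 +i* L2)%C) =
    \sum_(i <- A) complex.Im (a i) - L2.
  by rewrite raddfB raddf_sum.
lra.
Qed.

End Nets.

Section SeriesSum.
Variables (R : realType) (k : nat).
Local Notation C := (Cplx R).
Local Notation vec := {ffun 'I_k -> nat}.
Implicit Types (a : vec -> C) (A : {fset vec}).

Definition on_posvec (V : nmodType) (a : vec -> V) : vec -> V :=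
  patch (fun=> 0) (@posvec k) a.

Lemma on_posvec_in (V : nmodType) (a : vec -> V) n :
  posvec n -> on_posvec a n = a n.
Proof. by move=> n0; rewrite /on_posvec /patch mem_set. Qed.

Lemma on_posvec_out (V : nmodType) (a : vec -> V) n :
  ~ posvec n -> on_posvec a n = 0.
Proof. by move=> n0; rewrite /on_posvec /patch memNset. Qed.

Lemma cmod_on_posvec a n :
  cmod (on_posvec a n) = on_posvec (fun m => cmod (a m)) n.
Proof.
have [n0|n0] := pselect (posvec n); first by rewrite !on_posvec_in.
by rewrite !on_posvec_out // cmod0.
Qed.

Lemma abs_convergent_bound a : abs_convergent a ->
  exists M, forall A, \sum_(n <- A) cmod (on_posvec a n) <= M.
Proof.
rewrite /abs_convergent /summable.
set S := esum _ _ => Sfin.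
have S0 : (0 <= S)%E by apply: esum_ge0.
exists (fine S) => A.
rewrite -lee_fin fineK ?ge0_fin_numE // -sumEFin.
apply: esum_ge; exists ([set` A] `&` @posvec k).
  by split; [apply: finite_setIl; exact: finite_fset | by move=> ? []].
rewrite le_eqVlt; apply/orP; left; apply/eqP.
rewrite fsbig_mkcondr [LHS]fsbig_seq ?fset_uniq //.
apply: eq_fsbigr => n _; rewrite cmod_on_posvec.
case: ifPn => [/set_mem|/negP] n0.
  by rewrite on_posvec_in // gee0_abs // lee_fin cmod_ge0.
by rewrite on_posvec_out // => /mem_set.
Qed.

Lemma series_sum_net a : abs_convergent a -> forall e, 0 < e ->
  exists A0, forall A, (A0 `<=` A)%fset ->
    cmod (\sum_(n <- A) on_posvec a n - series_sum a) < e.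
Proof.
move=> /abs_convergent_bound[M aM].
have [L HL] := complex_net_limit aM.
suff -> : series_sum a = L by [].
have FF : ProperFilter (@summability.totally vec) := summability.totally_filter.
apply: cvg_lim; first exact: norm_hausdorff.
apply/cvgrPdist_lt => _ /gt0_complex_real[e e0 ->].
have [A0 HA0] := HL _ e0.
exists A0 => //= A A0A.
rewrite distrC normC_cmod ltcR.
suff -> : summability.partial_sum (patch (fun=> 0) (posvec (k:=k)) a) A =
    \sum_(n <- A) on_posvec a n by exact: HA0.
by rewrite /summability.partial_sum [RHS]big_seq_fsetE.
Qed.

End SeriesSum.

(** * The sum over a ball *)

Section BallSum.
Variables (R : realType) (k : nat).
Local Notation C := (Cplx R).
Local Notation vec := {ffun 'I_k -> nat}.
Implicit Types (F : vec -> C) (A : {fset vec}).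

(** [moebius_inversion] is inserted in the sum of [F] and the sums over [n] and
    over its divisors [d] are exchanged. *)
Lemma ball_sum_box F K (y : R) : 0 <= y <= K%:R ->
  ball_sum F (y ^+ 2) =
  \sum_(d : {ffun 'I_k -> 'I_K.+1} | [forall i, (0 < d i)%N])
    dconv (@moebiusv R k) F (vec_of_box d) *
    (sublattice_count K (vec_of_box d) y)%:C.
Proof.
move=> /andP[y0 yK]; rewrite /ball_sum (@fsum_box k K); last first.
  move=> d [_ dy] i; rewrite -(ler_nat R); apply: le_trans yK.
  rewrite -(@ler_pXn2r _ 2) ?nnegrE //; apply: le_trans dy.
  by rewrite -natrX ler_nat (bigD1 i) //= leq_addr.
under eq_bigr => n /asboolP[n0 _].
  rewrite (moebius_inversion F n0); over.
rewrite (exchange_big_dep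
  (fun d : {ffun 'I_k -> 'I_K.+1} => [forall i, (0 < d i)%N])) /=; last first.
  move=> n d /asboolP[n0 _] /forallP dn; apply/forallP => i.
  by apply: dvdn_gt0 (dn i); have := n0 i; rewrite vec_of_boxE.
apply: eq_bigr => d _; rewrite /sublattice_count rmorph_sum /= mulr_sumr.
apply: eq_big => [n|n _]; last by rewrite mulr1.
apply/andP/andP => [[/asboolP[n0 ny] /forallP dn]|[/forallP h ny]].
  split; last by move: ny; under eq_bigr do rewrite vec_of_boxE.
  apply/forallP => i; rewrite vec_of_boxE dn andbT.
  by have := n0 i; rewrite vec_of_boxE.
split; last by apply/forallP => i; have := h i; rewrite vec_of_boxE => /andP[].
apply/asboolP; split; last by under eq_bigr do rewrite vec_of_boxE.
by move=> i; rewrite vec_of_boxE; case/andP: (h i).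
Qed.

Definition box_fset K : {fset vec} :=
  [fset vec_of_box n | n in {: {ffun 'I_k -> 'I_K.+1}}]%fset.

Lemma ball_sum_fset F K (y : R) A :
  0 <= y <= K%:R -> (box_fset K `<=` A)%fset ->
  ball_sum F (y ^+ 2) =
  \sum_(d <- A)
    on_posvec (dconv (@moebiusv R k) F) d * (sublattice_count K d y)%:C.
Proof.
move=> yK BA; rewrite (ball_sum_box F yK).
rewrite -(big_fset_incl _ BA) /=; last first.
  move=> d _ dB; have [d0|d0] := pselect (posvec d); last first.
    by rewrite on_posvec_out // mul0r.
  rewrite /sublattice_count big_pred0 ?mulr0 // => n.
  apply/negP => /andP[/forallP h _]; case/negP: dB.
  have [|m ->] := @vec_of_box_surj k K d.
    move=> i; have /andP[n0 dn] := h i.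
    by rewrite (leq_trans (dvdn_leq n0 dn)) // -ltnS.
  by apply/imfsetP; exists m.
rewrite big_imfset /=; last by move=> m n _ _; exact: vec_of_box_inj.
rewrite big_enum /= big_mkcond /=.
apply: eq_bigr => d _; case: ifPn => [/forallP d0|/negP d0].
  by rewrite on_posvec_in // => i; rewrite vec_of_boxE.
rewrite on_posvec_out ?mul0r // => h; apply: d0; apply/forallP => i.
by have := h i; rewrite vec_of_boxE.
Qed.

Lemma vprodC (n : vec) : \prod_(i < k) (n i)%:R = (vprod R n)%:C :> C.
Proof. by rewrite rmorph_prod; apply: eq_bigr => i _; rewrite rmorph_nat. Qed.

(** Termwise comparison of the sum over the ball with the series [BF F].  The
    bound [Bd] may be checked on arbitrarily large finite sets, and so the tail
    of the series never has to be written down. *)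
Lemma net_estimate F (y : R) (w : vec -> R) (Bd : R) (A0 : {fset vec}) :
  0 <= y ->
  abs_convergent
    (fun n => dconv (@moebiusv R k) F n / \prod_(i < k) (n i)%:R) ->
  (forall K d, posvec d -> y <= K%:R ->
    `|sublattice_count K d y - ball_coef R k * y ^+ k / vprod R d| <= w d) ->
  (forall A, (A0 `<=` A)%fset ->
    \sum_(d <- A) cmod (on_posvec (dconv (@moebiusv R k) F) d) * w d <= Bd) ->
  cmod (ball_sum F (y ^+ 2) - (ball_coef R k)%:C * BF F * (y ^+ k)%:C) <= Bd.
Proof.
move=> y0 Fsum cntE wB; set g := dconv _ F in Fsum wB *.
pose c := ball_coef R k * y ^+ k.
have c0 : 0 <= c.
  by rewrite mulr_ge0 ?exprn_ge0 //; case/andP: (ball_coef_bounds R k).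
apply/ler_addgt0Pr => e e0.
(* [c + 1] rather than [c], which vanishes with [y]. *)
have e1 : 0 < e / (c + 1) by rewrite divr_gt0 // ltr_pwDr.
have [A1 HA1] := series_sum_net Fsum e1.
pose K := (Num.truncn y).+1.
have yK : y <= K%:R by rewrite ltW // truncnS_gt.
pose A := (A0 `|` A1 `|` box_fset K)%fset.
rewrite (@ball_sum_fset F K y A) ?y0 ?yK //; last exact: fsubsetUr.
have A0A : (A0 `<=` A)%fset by rewrite /A -fsetUA fsubsetUl.
have A1A : (A1 `<=` A)%fset by rewrite /A fsetUAC fsubsetUr.
have E : \sum_(d <- A) on_posvec g d * (sublattice_count K d y)%:C
    - (ball_coef R k)%:C * BF F * (y ^+ k)%:C =
  \sum_(d <- A) on_posvec g d * (sublattice_count K d y - c / vprod R d)%:C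
  + c%:C * (\sum_(d <- A) on_posvec (fun n => g n / \prod_(i < k) (n i)%:R) d
            - BF F).
  have -> : (ball_coef R k)%:C * BF F * (y ^+ k)%:C = c%:C * BF F.
    by rewrite mulrAC -rmorphM.
  rewrite mulrBr addrA mulr_sumr -big_split /=; congr (_ - _).
  apply: eq_bigr => d _; have [d0|d0] := pselect (posvec d).
    by rewrite !on_posvec_in // vprodC rmorphB /= fmorph_div /=; ring.
  by rewrite !on_posvec_out // !mul0r mulr0 addr0.
rewrite E; apply: le_trans (le_cmodD _ _) _; apply: lerD.
  apply: le_trans (le_cmod_sum _ _) _; apply: le_trans (wB _ A0A).
  apply: ler_sum => d _; rewrite cmodM cmod_real.
  have [d0|d0] := pselect (posvec d); last first.
    by rewrite !on_posvec_out // cmod0 !mul0r.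
  by rewrite ler_wpM2l ?cmod_ge0 // cntE.
rewrite cmodM cmod_real ger0_norm //.
have := ltW (HA1 _ A1A); rewrite -/(BF F) => h.
apply: le_trans (ler_wpM2l c0 h) _.
by rewrite mulrA ler_pdivrMr ?ltr_pwDr // mulrC ler_pM2l // lerDl.
Qed.

End BallSum.

Section Convergence.
Variables (R : realType) (k : nat).
Local Notation C := (Cplx R).
Local Notation vec := {ffun 'I_k -> nat}.
Implicit Types (a : vec -> C) (d : vec) (A : {fset vec}).

Lemma natpowC_real n (z : R) : (0 < n)%N ->
  natpowC n (z%:C : C) = (n%:R `^ z)%:C.
Proof.
move=> n0; rewrite /natpowC /cexp -rmorphM /= cos0 sin0.
rewrite /powR pnatr_eq0 -[n == 0%N]negbK -lt0n n0 /=.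
by rewrite -[(1 +i* 0)%C]/(1 : C) mulr1.
Qed.

Lemma abs_convergent_weight a (z : 'I_k -> R) :
  abs_convergent (fun n => a n / \prod_(j < k) natpowC (n j) ((z j)%:C : C)) ->
  exists M, forall A,
    \sum_(d <- A) cmod (on_posvec a d) / \prod_j ((d j)%:R `^ z j) <= M.
Proof.
move=> /abs_convergent_bound[M aM]; exists M => A.
apply: le_trans (aM A); apply: ler_sum => d _.
have [d0|d0] := pselect (posvec d); last first.
  by rewrite !on_posvec_out // cmod0 mul0r.
rewrite !on_posvec_in // cmodM cmodV.
under [X in _ <= _ / cmod X]eq_bigr do rewrite natpowC_real //.
rewrite -rmorph_prod cmod_real ger0_norm // prodr_ge0 //.
Qed.

Lemma abs_convergent_natpowC1 a :
  abs_convergent (fun n => a n / \prod_(j < k) natpowC (n j) (1%:C : C)) ->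
  abs_convergent (fun n => a n / \prod_(j < k) (n j)%:R).
Proof.
rewrite /abs_convergent /summable.
suff -> : (\esum_(n in @posvec k)
      `|(cmod (a n / \prod_(j < k) natpowC (n j) (1%:C : C)))%:E| =
    \esum_(n in @posvec k) `|(cmod (a n / \prod_(j < k) (n j)%:R))%:E|)%E by [].
apply: eq_esum => n n0; congr (`|(cmod (_ / _))%:E|)%E.
by apply: eq_bigr => j _; rewrite natpowC_real // powRr1 // rmorph_nat.
Qed.

(** The second bound is the better one unless [vsum R d] exceeds [y]; the first
    one serves for the infinitely many remaining [d]. *)
Lemma sublattice_count_err K d (y : R) : posvec d -> 0 <= y <= K%:R ->
  `|sublattice_count K d y - ball_coef R k * y ^+ k / vprod R d| <=
    y ^+ k / vprod R d /\
  `|sublattice_count K d y - ball_coef R k * y ^+ k / vprod R d| <=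
    y ^+ k.-1 * vsum R d / vprod R d.
Proof.
move=> d0 yK; have /andP[lo up] := sublattice_count_bounds d0 yK.
have /andP[y0 _] := yK.
have /andP[c0 c1] := ball_coef_bounds R k.
have P0 := vprod_gt0 R d0.
have N0 : 0 <= sublattice_count K d y by apply: sumr_ge0.
have h : ball_coef R k * y ^+ k / vprod R d <= y ^+ k / vprod R d.
  by rewrite ler_pM2r ?invr_gt0 // ler_piMl ?exprn_ge0.
rewrite distrC ger0_norm ?subr_ge0 //; split; lra.
Qed.

(** If all [d j] are at most [y], then [d j = d j `^ t * d j `^ (1 - t)] is at
    most [y `^ t * d j `^ (1 - t)] and the second bound of
    [sublattice_count_err] suffices.  Otherwise some [d j] exceeds [y], and
    [y = y `^ t * y `^ (1 - t)] is at most [y `^ t * d j `^ (1 - t)], so that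
    the first bound does. *)
Lemma sublattice_count_err_pow K d (y t : R) : (0 < k)%N -> 0 < t -> t < 1 ->
  posvec d -> 0 < y -> y <= K%:R ->
  `|sublattice_count K d y - ball_coef R k * y ^+ k / vprod R d| <=
    y ^+ k.-1 * y `^ t * (\sum_j (d j)%:R `^ (1 - t) / vprod R d).
Proof.
move=> k0 t0 t1 d0 y0 yK.
have yK' : 0 <= y <= K%:R by rewrite (ltW y0).
have [e1 e2] := sublattice_count_err d0 yK'.
have P0 := vprod_gt0 R d0.
have yk0 : 0 < y ^+ k.-1 by rewrite exprn_gt0.
rewrite -mulr_suml mulrA.
have yt : y `^ t * y `^ (1 - t) = y.
  by rewrite -powRD ?(gt_eqF y0) ?implybT // addrC subrK powRr1 // ltW.
have [j yd|dy] := pickP (fun j => y < (d j)%:R).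
  apply: (le_trans e1); rewrite ler_pM2r ?invr_gt0 //.
  rewrite -{1}(prednK k0) exprSr -mulrA ler_pM2l //.
  rewrite -{1}yt ler_pM2l ?powR_gt0 //.
  apply: (@le_trans _ _ ((d j)%:R `^ (1 - t))).
    by rewrite ge0_ler_powR ?nnegrE ?(ltW yd) ?(ltW y0) // subr_ge0 ltW.
  rewrite (bigD1 j) //= lerDl sumr_ge0 // => i _; exact: powR_ge0.
apply: (le_trans e2); rewrite ler_pM2r ?invr_gt0 // -mulrA ler_pM2l //.
rewrite mulr_sumr; apply: ler_sum => j _.
have dj0 : 0 < (d j)%:R :> R by rewrite ltr0n.
have djE : (d j)%:R `^ t * (d j)%:R `^ (1 - t) = (d j)%:R :> R.
  by rewrite -powRD ?(gt_eqF dj0) ?implybT // addrC subrK powRr1 // ltW.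
rewrite -{1}djE ler_pM2r ?powR_gt0 //.
have /negbT := dy j; rewrite -leNgt => djy.
by rewrite ge0_ler_powR ?nnegrE ?(ltW y0) ?(ltW t0).
Qed.

End Convergence.

Lemma powR_half_nat (R : realType) (y : R) (k : nat) : 0 <= y ->
  (y ^+ 2) `^ (k%:R / 2) = y ^+ k.
Proof.
move=> y0; rewrite [k%:R / 2]mulrC powRrM powR12_sqrt ?sqr_ge0 //.
by rewrite sqrtr_sqr ger0_norm // powR_mulrn.
Qed.

Section Main.
Variables (R : realType) (k : nat) (F : {ffun 'I_k -> nat} -> Cplx R).
Local Notation C := (Cplx R).
Local Notation vec := {ffun 'I_k -> nat}.
Local Notation g := (dconv (@moebiusv R k) F).
Local Notation abs_convergent_BF :=
  (abs_convergent (fun n => g n / \prod_(i < k) (n i)%:R)).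

(** The finite set [A0] carries all but [e / 4] of the sum of [q]; outside it
    the first bound of [sublattice_count_err] is used, on it the second one, of
    which the total [Q] is independent of [y]. *)
Lemma ball_sum_main_term (e : R) : (0 < k)%N -> abs_convergent_BF -> 0 < e ->
  exists Y : R, 0 < Y /\ forall y, Y <= y ->
    cmod (ball_sum F (y ^+ 2) - (ball_coef R k)%:C * BF F * (y ^+ k)%:C) <
      e * y ^+ k.
Proof.
move=> k_gt0 Bsum e0; pose og := on_posvec g.
pose q d := cmod (og d) / vprod R d.
have q0 d : 0 <= q d.
  by rewrite mulr_ge0 ?cmod_ge0 // invr_ge0 prodr_ge0.
have [M qM] := abs_convergent_bound Bsum.
have {}qM (A : {fset vec}) : \sum_(d <- A) q d <= M.
  apply: le_trans (qM A); apply: ler_sum => d _; rewrite /q /og.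
  have [d0|d0] := pselect (posvec d); last first.
    by rewrite !on_posvec_out // cmod0 mul0r.
  rewrite !on_posvec_in // cmodM cmodV vprodC cmod_real ger0_norm //.
  exact: ltW (vprod_gt0 R d0).
have [L HL] := ge0_net_limit q0 qM.
have e4 : 0 < e / 4 by lra.
have [A0 HA0] := HL _ e4.
pose Q := \sum_(d <- A0) q d * vsum R d.
have Q0 : 0 <= Q by apply: sumr_ge0 => d _; rewrite mulr_ge0 ?vsum_ge0.
exists (4 * (Q + 1) / e); split; first by rewrite !mulr_gt0 ?invr_gt0 //; lra.
move=> y yY.
have y0 : 0 < y.
  by apply: lt_le_trans yY; rewrite !mulr_gt0 ?invr_gt0 //; lra.
have yk0 : 0 < y ^+ k.-1 by rewrite exprn_gt0.
have ykE : y ^+ k = y ^+ k.-1 * y by rewrite -exprSr prednK.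
pose w (d : vec) := if d \in A0 then y ^+ k.-1 * vsum R d / vprod R d
                     else y ^+ k / vprod R d.
have := @net_estimate R k F y w (y ^+ k.-1 * Q + y ^+ k * (e / 2)) A0
  (ltW y0) Bsum.
have Qle : Q <= y * (e / 4).
  by move: yY; rewrite ler_pdivrMr //; lra.
move=> H; apply: le_lt_trans (H _ _) _.
- move=> K d d0 yK.
  have yK' : 0 <= y <= K%:R by rewrite (ltW y0).
  have [h1 h2] := sublattice_count_err d0 yK'.
  by rewrite /w; case: ifP.
- move=> A A0A; rewrite (sum_fset_sub _ A0A); apply: lerD.
    rewrite mulr_sumr big_seq [leRHS]big_seq; apply: ler_sum => d dA0.
    by rewrite /w dA0 /q /og -!mulrA [vsum R d / _]mulrC [cmod _ * _]mulrCA.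
  have /andP[h1 _] := HA0 _ (fsubset_refl A0).
  have /andP[_ h2] := HA0 _ A0A.
  rewrite (sum_fset_sub _ A0A) in h2.
  apply: (@le_trans _ _ (y ^+ k * \sum_(d <- A | d \notin A0) q d)).
    rewrite mulr_sumr; apply: ler_sum => d /negbTE dA0.
    by rewrite /w dA0 /q /og [cmod _ * _]mulrCA.
  by rewrite ler_pM2l ?exprn_gt0 //; lra.
rewrite ykE.
have : y ^+ k.-1 * Q <= y ^+ k.-1 * (y * (e / 4)) by rewrite ler_pM2l.
have : 0 < y ^+ k.-1 * y * e by rewrite !mulr_gt0.
lra.
Qed.

(** The [j]th term of [sublattice_count_err_pow] turns the weight [1 / d j] into
    [d j `^ - t], whence the exponents of the premise. *)
Lemma ball_sum_error_term (t : R) : (0 < k)%N -> abs_convergent_BF ->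
  0 < t -> t < 1 ->
  (forall j, exists M, forall A : {fset vec},
    \sum_(d <- A) cmod (on_posvec g d) /
      \prod_i ((d i)%:R `^ (if i == j then t else 1)) <= M) ->
  exists M : R, forall y, 0 < y ->
    cmod (ball_sum F (y ^+ 2) - (ball_coef R k)%:C * BF F * (y ^+ k)%:C) <=
      M * (y ^+ k.-1 * y `^ t).
Proof.
move=> k_gt0 Bsum t0 t1 /choice[M HM]; exists (\sum_j M j) => y y0.
pose w (d : vec) := y ^+ k.-1 * y `^ t *
  (\sum_j (d j)%:R `^ (1 - t) / vprod R d).
apply: (@net_estimate R k F y w _ fset0 (ltW y0) Bsum) => [K d d0 yK|A _].
  exact: sublattice_count_err_pow.
have c0 : 0 <= y ^+ k.-1 * y `^ t.
  by rewrite mulr_ge0 ?powR_ge0 ?exprn_ge0 ?(ltW y0).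
rewrite mulrC.
apply: (@le_trans _ _ (y ^+ k.-1 * y `^ t * \sum_j \sum_(d <- A)
    cmod (on_posvec g d) / \prod_i ((d i)%:R `^ (if i == j then t else 1))));
  last first.
  by apply: ler_wpM2l => //; apply: ler_sum => j _.
rewrite exchange_big mulr_sumr; apply: ler_sum => d _.
rewrite /w mulrCA ler_wpM2l // mulr_sumr; apply: ler_sum => j _.
have [d0|d0] := pselect (posvec d); last first.
  by rewrite on_posvec_out // cmod0 !mul0r.
rewrite ler_wpM2l ?cmod_ge0 //.
have dj i : 0 < (d i)%:R :> R by rewrite ltr0n.
have djt : (d j)%:R `^ (1 - t) * (d j)%:R `^ t = (d j)%:R :> R.
  by rewrite -powRD ?(gt_eqF (dj j)) ?implybT // subrK powRr1 // ltW.
rewrite ler_pdivrMr ?vprod_gt0 // mulrC ler_pdivlMr; last first.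
  by apply: prodr_gt0 => i _; rewrite powR_gt0.
rewrite /vprod (bigD1 j) //= [leRHS](bigD1 j) //= eqxx mulrA djt ler_pM2l //.
apply: ler_prod => i /negbTE ij; rewrite ij powR_ge0 powRr1 //=.
Qed.

End Main.

Theorem theorem3p1 (R : realType) (k : nat) (hk : (1 <= k)%N)
    (F : {ffun 'I_k -> nat} -> Cplx R) (t : R) (ht0 : 0 < t) (ht1 : t <= 1)
    (hF : forall z : 'I_k -> Cplx R, (forall j, t <= complex.Re (z j)) ->
      abs_convergent (fun n =>
        dconv (@moebiusv R k) F n / \prod_(j < k) natpowC (n j) (z j))) :
  (t = 1 ->
    ball_sum F x / (x `^ (k%:R / 2))%:C @[x --> +oo]
      --> ((unit_ball_volume R k / 2 ^+ k)%:C * BF F : Cplx R)) /\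
  (t < 1 ->
    exists M : R, \forall x \near +oo,
      cmod (ball_sum F x
            - (unit_ball_volume R k / 2 ^+ k)%:C * BF F * (x `^ (k%:R / 2))%:C)
        <= M * x `^ ((k%:R - 1 + t) / 2)).
Proof.
rewrite unit_ball_volumeE.
have Bsum : abs_convergent
    (fun n => dconv (@moebiusv R k) F n / \prod_(i < k) (n i)%:R).
  by apply: abs_convergent_natpowC1; apply: hF.
split=> [_|t1].
  apply/cvgrPdist_lt => _ /gt0_complex_real[e e0 ->].
  have [Y [Y0 HY]] := ball_sum_main_term hk Bsum e0.
  near=> x.
  have xY : Y ^+ 2 <= x by near: x; apply: nbhs_pinfty_ge; exact: num_real.
  have x0 : 0 <= x by apply: le_trans xY; exact: sqr_ge0.
  pose y := Num.sqrt x; have y2 : x = y ^+ 2 by rewrite sqr_sqrtr.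
  have yY : Y <= y by rewrite -(ger0_norm (ltW Y0)) -sqrtr_sqr ler_wsqrtr.
  have y0 : 0 < y by exact: lt_le_trans yY.
  have yk0 : 0 < y ^+ k by rewrite exprn_gt0.
  rewrite y2 powR_half_nat ?(ltW y0) // distrC normC_cmod ltcR.
  have ykN0 : (y ^+ k)%:C != 0 :> Cplx R by rewrite fmorph_eq0 gt_eqF.
  rewrite -[(ball_coef R k)%:C * _](mulfK ykN0) -mulrBl cmodM cmodV cmod_real.
  by rewrite gtr0_norm // ltr_pdivrMr // HY.
have [j|M HM] := ball_sum_error_term hk Bsum ht0 t1.
  apply: (abs_convergent_weight (z := fun i => if i == j then t else 1)).
  by apply: hF => i /=; case: ifP.
exists M; near=> x.
have x0 : 0 < x by near: x; exact: nbhs_pinfty_gt.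
pose y := Num.sqrt x; have y2 : x = y ^+ 2 by rewrite sqr_sqrtr // ltW.
have y0 : 0 < y by rewrite sqrtr_gt0.
have -> : x `^ ((k%:R - 1 + t) / 2) = y ^+ k.-1 * y `^ t.
  rewrite [_ / 2]mulrC powRrM powR12_sqrt ?(ltW x0) // -/y.
  rewrite -powR_mulrn ?(ltW y0) // -powRD ?(gt_eqF y0) ?implybT //.
  by congr (_ `^ (_ + _)); rewrite -[k in LHS](prednK hk) -natr1 addrK.
by rewrite y2 powR_half_nat ?(ltW y0) // HM.
Unshelve. all: by end_near. Qed.
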